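(* Let $X$ be a real Banach space and let $f:\mathbb{R}\to X$ be arbitrary. Then there exists a set $M\subset\mathbb{R}$ of Lebesgue measure zero such that: if $x\in\mathbb{R}\setminus M$ and $\min(mD^-(f,x),mD^+(f,x))<\infty$, then $f$ is metrically differentiable at $x$.
   Context: For $f:\mathbb{R}\to X$ and $x\in\mathbb{R}$: $mD^{\pm}(f,x)=\limsup_{t\to0+}\frac{\|f(x\pm t)-f(x)\|}{t}\in[0,+\infty]$. The unilateral metric derivatives are $md_{\pm}(f,x)=\lim_{t\to0+}\frac{\|f(x\pm t)-f(x)\|}{t}$; if both exist and are equal (and finite), their common value is the metric derivative $md(f,x)$. The mapping $f$ is metrically differentiable at $x$ if $md(f,x)$ exists and $\|f(y)-f(z)\|-md(f,x)|y-z|=o(|y-x|+|z-x|)$ as $(y,z)\to(x,x)$. *)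

(* Defs.v *)
From HB Require Import structures.
From mathcomp Require Import all_boot all_order all_algebra.
From mathcomp Require Import all_classical all_reals all_analysis.

Set Implicit Arguments.
Unset Strict Implicit.
Unset Printing Implicit Defensive.

Import Order.TTheory GRing.Theory Num.Theory.
Import numFieldNormedType.Exports.

Local Open Scope classical_set_scope.
Local Open Scope ring_scope.

Definition mquot_plus (R : realType) (X : normedModType R) (f : R -> X)
  (x t : R) : \bar R := (`|f (x + t) - f x| / t)%:E.

Definition mquot_minus (R : realType) (X : normedModType R) (f : R -> X)
  (x t : R) : \bar R := (`|f (x - t) - f x| / t)%:E.

Definition mD_plus (R : realType) (X : normedModType R) (f : R -> X) (x : R)
  : \bar R := limf_esup (mquot_plus f x) 0^'+.

Definition mD_minus (R : realType) (X : normedModType R) (f : R -> X) (x : R)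
  : \bar R := limf_esup (mquot_minus f x) 0^'+.

(* Metric derivatives are relations: [is_md f x m] reads "md(f, x) exists, is
   finite, and equals m". Limits are unique, so m is determined by f and x. *)
Definition is_md_plus (R : realType) (X : normedModType R) (f : R -> X)
  (x : R) (l : \bar R) : Prop := mquot_plus f x t @[t --> 0^'+] --> l.

Definition is_md_minus (R : realType) (X : normedModType R) (f : R -> X)
  (x : R) (l : \bar R) : Prop := mquot_minus f x t @[t --> 0^'+] --> l.

Definition is_md (R : realType) (X : normedModType R) (f : R -> X) (x m : R)
  : Prop := is_md_plus f x m%:E /\ is_md_minus f x m%:E.

(* The full neighbourhood filter of (x, x) may be used: at the pair (x, x)
   itself both sides vanish. *)
Definition metrically_differentiable (R : realType) (X : normedModType R)
  (f : R -> X) (x : R) : Prop :=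
  exists2 m : R, is_md f x m &
    (fun p : R * R => `|f p.1 - f p.2| - m * `|p.1 - p.2| : R^o)
      =o_ (nbhs (x, x)) (fun p : R * R => `|p.1 - x| + `|p.2 - x| : R^o).

(* Main.v *)
(** Stratify the exceptional points by one-sided Lipschitz bounds: let E be the
    set of x in a short interval with |f (x + t) - f x| <= L t for 0 < t < r
    (or with x - t in place of x + t). Then f is L-Lipschitz on E. For the
    countable dense family d_n in E the real functions |f - f (d_n)| on E extend
    to Lipschitz functions on R, which have bounded densities g_n by
    Radon-Nikodym. With m = sup_n |g_n|, for y <= z in E,
      |\int_y^z g_n| <= |f z - f y| <= \int_y^z m,
    so at a common Lebesgue point x of m and all the g_n the restriction of f to
    E has metric derivative m x at x, in the strong two-point sense.
    Almost every x in E is moreover a density point of the closure of E, so each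
    y near x has a point y' of E within o(|y - x|) on whichever side is wanted,
    and the one-sided bound at y' gives |f y - f y'| = o(|y - x|). Hence the
    expansion on E extends to all y and z near x. *)
Require Import Defs.
From HB Require Import structures.
From mathcomp Require Import all_boot all_order all_algebra.
From mathcomp Require Import all_classical all_reals all_analysis.
From mathcomp Require Import measurable_realfun ring lra.

Set Implicit Arguments.
Unset Strict Implicit.
Unset Printing Implicit Defensive.

Import Order.TTheory GRing.Theory Num.Theory.
Import numFieldNormedType.Exports.

Local Open Scope classical_set_scope.
Local Open Scope ring_scope.

(** * Densities of Lipschitz functions *)

Lemma dominated_density d (T : measurableType d) (R : realType)
    (mu : {sigma_finite_measure set T -> \bar R})
    (nu : {finite_measure set T -> \bar R}) :
    (forall A, measurable A -> (nu A <= mu A)%E) ->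
  exists p : T -> R, [/\ measurable_fun setT p, forall x, 0 <= p x <= 1 &
    forall A, measurable A -> nu A = (\int[mu]_(x in A) (p x)%:E)%E].
Proof.
move=> numu.
have dom : nu `<< mu.
  apply/null_content_dominatesP => A mA muA0.
  by apply/eqP; rewrite -measure_le0 -muA0 numu.
have [f [f0 ffin intf fE]] := radon_nikodym_sigma_finite dom.
have [p0 fp0] : exists p0 : T -> R, f = EFin \o p0.
  by exists (fine \o f); apply/funext => x /=; rewrite fineK.
subst f; have p00 x : 0 <= p0 x by have := f0 x; rewrite lee_fin.
have mp0 : measurable_fun setT p0 by case/integrableP : intf => /measurable_EFinP.
pose B : set T := [set x | 1 < p0 x].
have mB : measurable B.
  rewrite (_ : B = p0 @^-1` `]1, +oo[%classic); last first.
    by apply/seteqP; split => x /=; rewrite in_itv/= andbT.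
  by rewrite -[X in measurable X]setTI; exact: mp0.
have mf1 : measurable_fun B (EFin \o p0).
  by apply/measurable_EFinP; exact: measurable_funTS.
have muBfin : (mu B < +oo)%E.
  apply: (@le_lt_trans _ _ (nu B)); last by rewrite ltey_eq fin_num_measure.
  rewrite fE// -[leLHS]mul1e -integral_cst//.
  by apply: ge0_le_integral => //= x /ltW; rewrite lee_fin.
have muB0 : mu.-negligible B.
  have intB : mu.-integrable B (EFin \o p0) by exact: integrableS intf.
  have int1 : mu.-integrable B (EFin \o cst 1).
    by apply: measurable_bounded_integrable => //; exact: bounded_cst.
  have : (\int[mu]_(x in B) `|(p0 x - 1)%:E| = 0)%E.
    apply/eqP; rewrite eq_le integral_ge0 ?andbT//.
    rewrite (@eq_integral _ _ _ mu B
      (fun x => (EFin \o p0) x - (EFin \o cst 1%R) x)%E); last first.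
      by move=> x /[!inE] /= p1; rewrite gtr0_norm ?subr_gt0.
    rewrite integralB//= (integral_cst mu mB 1%E) mul1e -fE//.
    by rewrite sube_le0// ?numu// fin_num_measure.
  move/ae_eq_integral_abs => /(_ mB) h.
  have [|N [mN muN sN]] := h.
    by apply/measurable_EFinP/measurable_funB => //; exact: measurable_funTS.
  exists N; split => // x Bx; apply: sN => /= /(_ Bx) [] /eqP.
  by rewrite subr_eq0 gt_eqF.
exists (fun x => Num.min (p0 x) 1); split.
- exact: measurable_minr.
- by move=> x; rewrite le_min p00 ler01 ge_min lexx orbT.
move=> A mA.
rewrite fE//; apply: ae_eq_integral => //.
- by apply/measurable_EFinP; exact: measurable_funTS.
- by apply/measurable_EFinP/measurable_funTS/measurable_minr.
- apply: negligibleS muB0 => x /= /not_implyP[Ax].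
  apply: contra_notP => /negP; rewrite -leNgt => p1.
  by rewrite (min_idPl p1).
Qed.

Section density.
Context {R : realType}.
Local Notation mu := (@lebesgue_measure R).

Lemma lebesgue_measure_itvoc (a b : R) : a <= b ->
  mu `]a, b]%classic = (b - a)%:E.
Proof.
move=> ab; rewrite lebesgue_measure_itv/= lte_fin.
by case: ltgtP ab => // -> _; rewrite subrr.
Qed.

Lemma bounded_integrable (D : set R) (q : R -> R) (M : R) :
    measurable D -> (mu D < +oo)%E ->
    measurable_fun setT q -> (forall x, `|q x| <= M) ->
  mu.-integrable D (EFin \o q).
Proof.
move=> mD Dfin mq qM; apply: measurable_bounded_integrable => //.
  exact: measurable_funTS.
exists M; split; first exact: num_real.
by move=> N MN x _ /=; rewrite (le_trans (qM x))// ltW.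
Qed.

Lemma bounded_integrable_itvoc (y z : R) (q : R -> R) (M : R) :
    measurable_fun setT q -> (forall x, `|q x| <= M) ->
  mu.-integrable `]y, z] (EFin \o q).
Proof.
apply: bounded_integrable => //.
by rewrite lebesgue_measure_itv/=; case: ifP => _; rewrite ?ltry// -EFinB ltry.
Qed.

Lemma nondecreasing_continuous_measure (h : R -> R) :
    {homo h : x y / x <= y} -> continuous h ->
  exists nu : {measure set (measurableTypeR R) -> \bar R},
    forall a b : R, a <= b -> nu `]a, b]%classic = (h b - h a)%:E.
Proof.
move=> hnd hc.
pose hM := isCumulative.Build R _ R h hnd (right_continuousW hc).
pose H : cumulative R R := HB.pack h hM.
exists (lebesgue_stieltjes_measure H) => a b ab /=.
rewrite /lebesgue_stieltjes_measure /measure_extension measurable_mu_extE/=;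
  last exact: is_ocitv.
by rewrite wlength_itv_bnd.
Qed.

Lemma le_lebesgue_of_le_itv (nu nu' : {measure set (measurableTypeR R) -> \bar R}) :
    (forall a b : R, a <= b ->
      (nu `]a, b]%classic + nu' `]a, b]%classic)%E = (b - a)%:E) ->
  forall A, measurable A -> (nu A <= mu A)%E.
Proof.
move=> nuE A mA.
rewrite (@lebesgue_measure_unique _ (measure_add nu nu'))//.
  by rewrite [leRHS]measure_addE leeDl.
move=> X [[a b] _ <-] /=.
rewrite [RHS]measure_addE; have [ab|ba] := leP a b.
  by rewrite nuE// lebesgue_measure_itvoc.
by rewrite set_itv_ge ?bnd_simp -?leNgt ?ltW// !measure0 adde0.
Qed.

Lemma nondecreasing_density (h : R -> R) (a b : R) :
    {homo h : x y / x <= y} -> continuous h ->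
    {homo (fun x => x - h x) : x y / x <= y} ->
  exists p : R -> R, [/\ measurable_fun setT p, forall x, 0 <= p x <= 1 &
    forall y z, a <= y -> y <= z -> z <= b ->
      h z - h y = \int[mu]_(x in `]y, z]) p x].
Proof.
move=> hnd hc wnd.
have [nu nuE] := nondecreasing_continuous_measure hnd hc.
have [|nu' nu'E] := nondecreasing_continuous_measure wnd.
  by move=> x; apply: cvgB; [exact: cvg_id|exact: hc].
have numu : forall A, measurable A -> (nu A <= mu A)%E.
  apply: (@le_lebesgue_of_le_itv nu nu') => x y xy.
  by rewrite nuE// nu'E// -EFinD; congr EFin; ring.
pose D : set (measurableTypeR R) := `]a, b]%classic.
have mD : measurable D by exact: measurable_itv.
have nuD : (nu D < +oo)%E.
  apply: le_lt_trans (numu _ mD) _.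
  by rewrite lebesgue_measure_itv/=; case: ifP => _; rewrite ?ltry// -EFinB ltry.
have [|p [mp p01 pE]] := @dominated_density _ _ _ mu (mfrestr mD nuD).
  move=> A mA; rewrite /mfrestr /mrestr (le_trans (numu _ _))//; first exact: measurableI.
  by rewrite le_measure ?inE//; exact: measurableI.
exists p; split => // y z ay yz zb.
have sub : (`]y, z]%classic : set (measurableTypeR R)) `<=` D.
  move=> x /=; rewrite !in_itv/= => /andP[yx xz].
  by apply/andP; split; [exact: le_lt_trans ay yx|exact: le_trans xz zb].
have E : nu `]y, z]%classic = (\int[mu]_(x in `]y, z]) (p x)%:E)%E.
  have := pE `]y, z]%classic (measurable_itv _).
  by move=> <-; congr (nu _); rewrite setIidl.
by rewrite /Rintegral -E nuE.
Qed.

Lemma lipschitz_density (u : R -> R) (L a b : R) : 0 < L ->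
    (forall x y, `|u x - u y| <= L * `|x - y|) ->
  exists g : R -> R, [/\ measurable_fun setT g, forall x, `|g x| <= L &
    forall y z, a <= y -> y <= z -> z <= b ->
      u z - u y = \int[mu]_(x in `]y, z]) g x].
Proof.
move=> L0 uL.
(* This [h] makes both [h] and [x - h x] nondecreasing. *)
pose h x := (u x + L * x) / (2 * L).
have L20 : 0 < 2 * L by lra.
have uxy x y : x <= y -> - (L * (y - x)) <= u y - u x <= L * (y - x).
  by move=> xy; have := uL y x; rewrite (ger0_norm (_ : 0 <= y - x)) ?subr_ge0// ler_norml.
have uc : continuous u.
  move=> x; apply/cvgrPdist_le => e e0; near=> y.
  rewrite (le_trans (uL _ _))// mulrC -ler_pdivlMr//.
  by near: y; apply: cvgr_dist_le; rewrite ?divr_gt0//; exact: cvg_id.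
have hnd : {homo h : x y / x <= y}.
  by move=> x y xy; rewrite /h ler_pM2r ?invr_gt0//; have /andP[] := uxy _ _ xy; lra.
have wnd : {homo (fun x => x - h x) : x y / x <= y}.
  move=> x y xy; rewrite -(ler_pM2r L20) !mulrBl /h !divfK ?gt_eqF//.
  by have /andP[] := uxy _ _ xy; lra.
have hc : continuous h.
  move=> x; apply: cvgM; last exact: cvg_cst.
  by apply: cvgD; [exact: uc|apply: cvgM; [exact: cvg_cst|exact: cvg_id]].
have [p [mp p01 pE]] := nondecreasing_density a b hnd hc wnd.
exists (fun x => 2 * L * p x - L); split.
- by apply: measurable_funB => //; exact: measurable_funM.
- by move=> x; rewrite ler_norml; have := p01 x; nra.
move=> y z ay yz zb.
have mD : measurable (`]y, z]%classic : set R) by exact: measurable_itv.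
have ip : mu.-integrable `]y, z] (EFin \o p).
  apply: (@bounded_integrable_itvoc _ _ _ 1) => // x.
  by rewrite ler_norml; have := p01 x; lra.
rewrite RintegralB//; last 2 first.
- by rewrite (_ : _ \o _ = fun x => ((2 * L)%:E * (EFin \o p) x)%E)//; exact: integrableZl.
- by apply: (@bounded_integrable_itvoc _ _ _ L) => // x; rewrite ger0_norm// ltW.
rewrite RintegralZl// -pE// Rintegral_cst//.
have -> : fine (mu `]y, z]%classic) = z - y by rewrite lebesgue_measure_itvoc.
rewrite /h -mulrBl.
by rewrite mulrC divfK ?gt_eqF//; ring.
Unshelve. all: end_near. Qed.

End density.

(** * Lebesgue points and density points *)

Section strong_derivative.
Context {R : realType}.
Local Notation mu := (@lebesgue_measure R).

Lemma bounded_locally_integrable (g : R -> R) (M : R) :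
  measurable_fun setT g -> (forall x, `|g x| <= M) -> locally_integrable setT g.
Proof.
move=> mg gM; split => //; first exact: openT.
move=> K _ cK; have mK : measurable K by exact: compact_measurable.
have /integrableP[] // : mu.-integrable K (EFin \o g).
by apply: bounded_integrable gM => //; exact: compact_finite_measure.
Qed.

Lemma lebesgue_pt_strong_derivative (g : R -> R) (M x : R) :
    measurable_fun setT g -> (forall x, `|g x| <= M) -> lebesgue_pt g x ->
  forall e, 0 < e -> exists2 d, 0 < d & forall y z, `|y - x| < d ->
    `|z - x| < d -> y <= z ->
    `|\int[mu]_(t in `]y, z]) g t - g x * (z - y)| <= e * (`|y - x| + `|z - x|).
Proof.
move=> mg gM gx e e0.
have e40 : 0 < e / 4 by rewrite divr_gt0.
have /fine_cvgP[[d1 /= d10 fin] /cvgrPdist_le /(_ _ e40)[d2 /= d20 le]] := gx.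
pose d := Num.min d1 d2.
have d0 : 0 < d by rewrite lt_min d10.
exists (d / 4); first by rewrite divr_gt0.
move=> y z yd zd yz; set S := `|y - x| + `|z - x|.
have ig (p q c : R) : mu.-integrable `]p, q] (EFin \o (fun t => g t - c)).
  apply: (@bounded_integrable_itvoc _ _ _ _ (M + `|c|)); first exact: measurable_funB.
  by move=> t; rewrite (le_trans (ler_normB _ _))// lerD.
have -> : \int[mu]_(t in `]y, z]) g t - g x * (z - y) =
    \int[mu]_(t in `]y, z]) (g t - g x).
  rewrite RintegralB//; last 2 first.
  - exact: bounded_integrable_itvoc gM.
  - by apply: (@bounded_integrable_itvoc _ _ _ _ M).
  rewrite Rintegral_cst//.
  by have -> : fine (mu `]y, z]%classic) = z - y by rewrite lebesgue_measure_itvoc.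
have [S0|S0] := leP S 0.
  have [yx zx] : y = x /\ z = x.
    by move: S0; rewrite /S => S0; split; apply/eqP; rewrite -subr_eq0 -normr_le0;
      have := normr_ge0 (y - x); have := normr_ge0 (z - x); lra.
  by rewrite yx zx set_itvoc0 Rintegral_set0 normr0 /S yx zx subrr normr0 addr0 mulr0.
pose r := 2 * S.
have r0 : 0 < r by rewrite mulr_gt0.
have rd : r < d by rewrite /r /S; lra.
have rd1 : ball 0 d1 r.
  by rewrite /ball/= sub0r normrN gtr0_norm// (lt_le_trans rd)// ge_min lexx.
have rd2 : ball 0 d2 r.
  by rewrite /ball/= sub0r normrN gtr0_norm// (lt_le_trans rd)// ge_min lexx orbT.
have {fin} fin := fin _ rd1 r0.
have {le} := le _ rd2 r0; rewrite sub0r normrN => /(le_trans (ler_norm _)).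
rewrite -lee_fin fineK// /davg /iavg.
rewrite (lebesgue_measure_ball _ (ltW r0)) inver mulrn_eq0/= gt_eqF//.
rewrite lee_pdivrMl ?mulrn_wgt0// => le.
rewrite (le_trans (le_normr_Rintegral _ (ig _ _ _)))//.
have sub : `]y, z]%classic `<=` ball x r.
  move=> t /=; rewrite in_itv/= /ball/= => /andP[yt tz].
  rewrite ltr_distlC; move: S0; rewrite /r /S.
  by have := ler_norm (z - x); have := ler_norm (x - y); rewrite distrC;
    have := normr_ge0 (y - x); have := normr_ge0 (z - x); lra.
rewrite -lee_fin /Rintegral fineK; last first.
  by apply: integrable_fin_num => //; exact: (integrable_norm (ig _ _ _)).
apply: le_trans (le_trans le _).
  apply: ge0_subset_integral => //; first exact: measurable_ball.
  apply/measurable_EFinP/measurableT_comp => //; apply: measurable_funTS.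
  exact: measurable_funB.
by rewrite -EFinM lee_fin /r mulr2n; lra.
Qed.

Lemma ae_strong_derivative (g : R -> R) (M : R) :
    measurable_fun setT g -> (forall x, `|g x| <= M) ->
  {ae mu, forall x, forall e, 0 < e -> exists2 d, 0 < d & forall y z, `|y - x| < d ->
    `|z - x| < d -> y <= z ->
    `|\int[mu]_(t in `]y, z]) g t - g x * (z - y)| <= e * (`|y - x| + `|z - x|)}.
Proof.
move=> mg gM.
have := lebesgue_differentiation (bounded_locally_integrable mg gM).
by apply: negligibleS => x /=; apply: contra_not; exact: lebesgue_pt_strong_derivative gM.
Qed.

Lemma ae_both_sides_dense (E : set R) :
  mu.-negligible (E `&` ~` [set x | forall e, 0 < e -> exists2 d, 0 < d &
    forall y, `|y - x| < d -> y != x ->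
      (exists2 z, E z & y - e * `|y - x| <= z <= y) /\
      (exists2 z, E z & y <= z <= y + e * `|y - x|)]).
Proof.
pose F := closure E.
have mF : measurable F by apply: closed_measurable; exact: closed_closure.
pose g : R -> R := \1_F.
have mg : measurable_fun setT g by exact: measurable_indic.
have gM x : `|g x| <= 1.
  by rewrite /g indicE ger0_norm//; case: (_ \in _); rewrite ?ler01 ?lexx.
have := ae_strong_derivative mg gM; apply: negligibleS => x [Ex /=].
apply: contra_not => gx e e0.
have gx1 : g x = 1 by rewrite /g indicE mem_set//; exact: subset_closure.
pose k := Num.min e 1.
have k0 : 0 < k by rewrite lt_min e0 ltr01.
have k1 : k <= 1 by rewrite ge_min lexx orbT.
have ke : k <= e by rewrite ge_min lexx.
have [|d d0 dP] := gx (k / 4); first by rewrite divr_gt0.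
have key a b : a < b -> `|a - x| < d -> `|b - x| < d ->
    k / 4 * (`|a - x| + `|b - x|) < b - a -> exists2 z, E z & a <= z <= b.
  move=> ab ad bd small; apply: contrapT => nE.
  have int0 : \int[mu]_(t in `]a, b]) g t = 0.
    have ->: \int[mu]_(t in `]a, b]) g t = \int[mu]_(t in `]a, b[) g t.
      rewrite Rintegral_itv_bndo_bndc//.
      apply: integrableS (@bounded_integrable_itvoc _ a b _ _ mg gM) => //.
      by apply: subset_itvl; rewrite bnd_simp.
    rewrite (@eq_Rintegral _ _ _ _ _ (cst 0)) ?Rintegral_cst ?mul0r//.
    move=> t /[!inE] /= tab; rewrite /g indicE memNset// => Ft.
    have [|z [Ez zab]] := Ft `]a, b[%classic.
      by apply: open_nbhs_nbhs; split => //; exact: interval_open.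
    apply: nE; exists z => //; move: zab; rewrite /= in_itv/= => /andP[az zb].
    by rewrite !ltW.
  have := dP _ _ ad bd (ltW ab); rewrite int0 gx1 mul1r sub0r normrN.
  by rewrite gtr0_norm ?subr_gt0// leNgt small.
exists (d / 2); first by rewrite divr_gt0.
move=> y yd yx.
have n0 : 0 < `|y - x| by rewrite normr_gt0 subr_eq0.
set n := `|y - x| in yd n0 *.
have kn0 : 0 < k * n by rewrite mulr_gt0.
have kn1 : k * n <= n by rewrite ler_piMl// ltW.
have kne : k * n <= e * n by rewrite ler_pM2r.
have knk : k * (k * n) <= k * n by rewrite ler_pM2l.
split.
  have yk : `|y - k * n - x| <= n + k * n.
    rewrite -addrA (addrC (- _)) addrA (le_trans (ler_normB _ _))//.
    by rewrite (gtr0_norm kn0).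
  have [||||z Ez /andP[z1 z2]] := key (y - k * n) y; try by rewrite -/n; lra.
    rewrite -/n; have : k / 4 * (`|y - k * n - x| + n) <= k / 4 * (n + k * n + n).
      by rewrite ler_pM2l ?divr_gt0// lerD2r.
    by lra.
  by exists z => //; lra.
have yk : `|y + k * n - x| <= n + k * n.
  rewrite addrAC (le_trans (ler_normD _ _))//.
  by rewrite (gtr0_norm kn0).
have [||||z Ez /andP[z1 z2]] := key y (y + k * n); try by rewrite -/n; lra.
  rewrite -/n; have : k / 4 * (n + `|y + k * n - x|) <= k / 4 * (n + (n + k * n)).
    by rewrite ler_pM2l ?divr_gt0// lerD2l.
  by lra.
by exists z => //; lra.
Qed.

End strong_derivative.

(** * Metric differentiability of Lipschitz maps on subsets of the line *)

Lemma lipschitz_extension {R : realType} (E : set R) (h : R -> R) (L : R) :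
    E !=set0 -> (forall x y, E x -> E y -> `|h x - h y| <= L * `|x - y|) ->
    0 <= L ->
  exists u : R -> R, (forall x y, `|u x - u y| <= L * `|x - y|) /\
    (forall x, E x -> u x = h x).
Proof.
move=> [e0 Ee0] hL L0.
pose S t := [set h e + L * `|t - e| | e in E].
have S0 t : S t !=set0 by exists (h e0 + L * `|t - e0|); exists e0.
have lb t x : E x -> lbound (S t) (h x - L * `|t - x|).
  move=> Ex _ [e Ee <-]; have := hL x e Ex Ee; rewrite ler_norml => /andP[_].
  have := ler_wpM2l L0 (ler_distD t x e); rewrite mulrDr (distrC x t).
  by lra.
have hlb t : has_lbound (S t) by exists (h e0 - L * `|t - e0|); exact: lb.
pose u t := inf (S t).
have uD t s : u t <= u s + L * `|t - s|.
  rewrite -lerBlDr; apply: lb_le_inf => // _ [e Ee <-].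
  have : u t <= h e + L * `|t - e| by apply: ge_inf => //; exists e.
  by have := ler_wpM2l L0 (ler_distD s t e); rewrite mulrDr; lra.
exists u; split=> [x y|x Ex].
  rewrite ler_norml; have := uD x y; have := uD y x; rewrite (distrC y x); lra.
apply/eqP; rewrite eq_le; apply/andP; split.
  by apply: ge_inf => //; exists x => //; rewrite subrr normr0 mulr0 addr0.
by apply: lb_le_inf => //; have := lb x x Ex; rewrite subrr normr0 mulr0 subr0.
Qed.

Lemma dense_sequence {R : realType} (E : set R) : E !=set0 ->
  exists d : nat -> R, (forall n, E (d n)) /\
    forall x e, E x -> 0 < e -> exists n, `|x - d n| < e.
Proof.
move=> [e0 Ee0].
have /choice[c cP] (i : rat * nat) : exists p, E p /\
    ((exists x, E x /\ `|x - ratr i.1| < i.2.+1%:R^-1) -> `|p - ratr i.1| < i.2.+1%:R^-1).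
  have [[x [Ex xi]]|nx] := pselect (exists x, E x /\ `|x - ratr i.1| < i.2.+1%:R^-1).
    by exists x.
  by exists e0; split => // /nx.
exists (fun n => if unpickle n is Some i then c i else e0); split.
  by move=> n; case: unpickle => // i; case: (cP i).
move=> x e Ex e_gt0.
have e20 : 0 < e / 2 by rewrite divr_gt0.
have [k ke] : exists k : nat, k.+1%:R^-1 < e / 2.
  exists (Num.truncn (e / 2)^-1); rewrite invf_plt ?posrE//.
  by rewrite truncnS_gt.
have k0 : 0 < k.+1%:R^-1 :> R by rewrite invr_gt0.
have xx : x - k.+1%:R^-1 < x + k.+1%:R^-1 by rewrite ltrD2l gtrN.
have [q] := rat_in_itvoo xx.
rewrite in_itv/= => /andP[q1 q2].
exists (pickle (q, k)); rewrite pickleK.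
have xq : `|x - ratr q| < k.+1%:R^-1 by rewrite ltr_distlC q1 q2.
have := (cP (q, k)).2 (ex_intro _ x (conj Ex xq)) => /=.
move: ke xq; move: (k.+1%:R^-1) => i ke xq.
by have := ler_distD (ratr q) x (c (q, k)); rewrite (distrC (ratr q)); lra.
Qed.

Section kirchheim.
Context {R : realType} (X : normedModType R).
Local Notation mu := (@lebesgue_measure R).

Lemma ae_metrically_differentiable_on (f : R -> X) (E : set R) (L a b : R) :
    0 < L -> E `<=` `[a, b] ->
    (forall x y, E x -> E y -> `|f x - f y| <= L * `|x - y|) ->
  mu.-negligible (E `&` ~` [set x | exists m, forall e, 0 < e ->
    exists2 d, 0 < d & forall y z, E y -> E z -> `|y - x| < d -> `|z - x| < d ->
      `| `|f y - f z| - m * `|y - z| | <= e * (`|y - x| + `|z - x|)]).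
Proof.
move=> L0 Eab fL.
have [->|/set0P E0] := eqVneq E set0; first by rewrite set0I; exact: negligible_set0.
have [d [Ed dE]] := dense_sequence E0.
have /choice[g gP] n : exists g : R -> R, [/\ measurable_fun setT g,
    forall x, `|g x| <= L &
    forall y z, E y -> E z -> y <= z ->
      `|f z - f (d n)| - `|f y - f (d n)| = \int[mu]_(t in `]y, z]) g t].
  have [||u [uL uE]] :=
    @lipschitz_extension _ E (fun x => `|f x - f (d n)|) L E0; last 2 first.
  - by rewrite ltW.
  - have [g [mg gL gE]] := lipschitz_density a b L0 uL.
    exists g; split => // y z Ey Ez yz; rewrite -gE// ?uE//.
    + by have := Eab _ Ey; rewrite /= in_itv/= => /andP[].
    + by have := Eab _ Ez; rewrite /= in_itv/= => /andP[].
  move=> x y Ex Ey; rewrite (le_trans (ler_dist_dist _ _))//.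
  by rewrite opprB addrA subrK fL.
have mg n : measurable_fun setT (g n) by case: (gP n).
have gL n x : `|g n x| <= L by case: (gP n).
have gE n y z : E y -> E z -> y <= z ->
    `|f z - f (d n)| - `|f y - f (d n)| = \int[mu]_(t in `]y, z]) g n t.
  by case: (gP n) => _ _; exact.
pose m t := sup [set `|g n t| | n in [set: nat]].
have hsup t : has_sup [set `|g n t| | n in [set: nat]].
  split; first by exists `|g 0%N t|, 0%N.
  by exists L => _ [n _ <-].
have gm n t : `|g n t| <= m t.
  by apply: sup_upper_bound => //; exists n.
have mm : measurable_fun setT m.
  have -> : m = fun t => sups (fun n => `|g n t|) 0%N.
    apply/funext => t; rewrite /m /sups /= /sdrop; congr sup.
    by apply/seteqP; split => _ [n _ <-]; exists n.
  apply: (@measurable_fun_sups _ _ _ _ (fun n t => `|g n t|)) => [t _|n].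
    by exists L => _ [n _ <-].
  exact: measurableT_comp.
have mL t : `|m t| <= L.
  rewrite ger0_norm ?(le_trans _ (gm 0%N t))//.
  by apply: ge_sup; [exact: (hsup t).1|move=> _ [n _ <-]].
have fm y z : E y -> E z -> y <= z -> `|f y - f z| <= \int[mu]_(t in `]y, z]) m t.
  move=> Ey Ez yz; apply/ler_addgt0Pr => e e0.
  have [|n dn] := dE y (e / (2 * L)) Ey; first by rewrite divr_gt0// mulr_gt0.
  have dL : `|f y - f (d n)| <= e / 2.
    rewrite (le_trans (fL _ _ Ey (Ed n)))// mulrC -ler_pdivlMr// (le_trans (ltW dn))//.
    by rewrite invfM mulrA.
  have : `|f z - f (d n)| - `|f y - f (d n)| <= \int[mu]_(t in `]y, z]) m t.
    rewrite gE//; apply: le_Rintegral => //.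
    - exact: bounded_integrable_itvoc (gL n).
    - exact: bounded_integrable_itvoc mL.
    - by move=> t _; rewrite (le_trans (ler_norm _)).
  have := ler_distD (f (d n)) (f y) (f z); rewrite (distrC (f (d n)) (f z)).
  lra.
have aeg := ae_foralln (fun n => ae_strong_derivative (mg n) (gL n)).
have aem := ae_strong_derivative mm mL.
have := negligibleU aem aeg; apply: negligibleS => x [Ex /=].
apply: contra_notP => /not_orP[/contrapT hm /contrapT hg].
exists (m x) => e e0; have e20 : 0 < e / 2 by rewrite divr_gt0.
have [_ [n _ <-] gn] := sup_adherent e20 (hsup x).
have [d1 d10 d1P] := hm _ e0.
have [d2 d20 d2P] := hg n _ e20.
exists (Num.min d1 d2); first by rewrite lt_min d10.
suff H y z : E y -> E z -> `|y - x| < Num.min d1 d2 -> `|z - x| < Num.min d1 d2 -> y <= z ->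
      `| `|f y - f z| - m x * `|y - z| | <= e * (`|y - x| + `|z - x|).
  move=> y z Ey Ez yd zd; have [yz|/ltW zy] := leP y z; first exact: H.
  by rewrite (distrC (f y)) (distrC y) (addrC `|y - x|); exact: H.
move=> Ey Ez; rewrite !lt_min => /andP[y1 y2] /andP[z1 z2] yz.
rewrite (distrC y z) (ger0_norm (_ : 0 <= z - y)) ?subr_ge0//.
have := d1P _ _ y1 z1 yz; have := d2P _ _ y2 z2 yz.
have := fm _ _ Ey Ez yz.
have lo : `|\int[mu]_(t in `]y, z]) g n t| <= `|f y - f z|.
  by rewrite -gE// (le_trans (ler_dist_dist _ _))// opprB addrA subrK distrC.
set S := `|y - x| + `|z - x|; set G := \int[mu]_(t in _) g n t in lo *.
set M := \int[mu]_(t in _) m t => FM GS MS.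
have zyS : z - y <= S.
  have := ler_distD x z y; rewrite (distrC x y) /S.
  by rewrite (ger0_norm (_ : 0 <= z - y)) ?subr_ge0//; lra.
have gxn : `|g n x * (z - y)| <= e / 2 * S + `|G|.
  by have := ler_distD G 0 (g n x * (z - y)); rewrite !sub0r !normrN; lra.
have zy0 : 0 <= z - y by rewrite subr_ge0.
rewrite normrM (ger0_norm zy0) in gxn.
have h1 : (m x - e / 2) * (z - y) <= `|g n x| * (z - y) by rewrite ler_wpM2r// ltW.
have h2 : e / 2 * (z - y) <= e / 2 * S by rewrite ler_wpM2l// ltW.
by move: MS; rewrite !ler_norml; lra.
Qed.
End kirchheim.

(** * One-sided bounds *)

Section one_sided.
Context {R : realType} (X : normedModType R) (f : R -> X).
Local Notation mu := (@lebesgue_measure R).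

Definition metric_slope (x m : R) := forall e, 0 < e ->
  exists2 d, 0 < d & forall y z, `|y - x| < d -> `|z - x| < d ->
    `| `|f y - f z| - m * `|y - z| | <= e * (`|y - x| + `|z - x|).

Lemma metric_slopeW (x m : R) : metric_slope x m -> metrically_differentiable f x.
Proof.
move=> fm; exists m.
  have slope q t e : 0 < t -> `|q - m * t| <= e * t -> `|m - q / t| <= e.
    move=> t0 h; have -> : m - q / t = (m * t - q) / t by rewrite mulrBl mulfK ?gt_eqF.
    by rewrite normrM normfV (gtr0_norm t0) ler_pdivrMr// distrC.
  split; apply/fine_cvgP; split; try exact: nearW;
    apply/cvgrPdist_le => e e0; have [d d0 dP] := fm _ e0; near=> t => /=;
    have t0 : 0 < t by [];
    have td : t < d by near: t; exact: nbhs_right_lt.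
  - have := dP (x + t) x; rewrite addrAC subrr add0r normr0 (gtr0_norm t0) addr0.
    by move=> /(_ td d0); exact: slope.
  - have := dP (x - t) x; rewrite addrAC subrr add0r normr0 normrN (gtr0_norm t0) addr0.
    by move=> /(_ td d0); exact: slope.
apply/eqoP => e e0; have [d d0 dP] := fm _ e0.
exists (ball x d, ball x d); first by split; exact: nbhsx_ballx.
move=> [y z] [/= yd zd].
have S0 : 0 <= `|y - x| + `|z - x| by rewrite addr_ge0.
by rewrite [X in _ <= _ * X](ger0_norm S0); apply: dP; rewrite distrC.
Unshelve. all: end_near. Qed.

Definition side (s : bool) (x t : R) := if s then x - t else x + t.

Lemma ae_metric_slope (E : set R) (s : bool) (L r a b : R) :
    0 < L -> E `<=` `[a, b] -> b - a < r -> 0 < r ->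
    (forall x t, E x -> 0 < t -> t < r -> `|f (side s x t) - f x| <= L * t) ->
  mu.-negligible (E `&` ~` [set x | exists m, metric_slope x m]).
Proof.
move=> L0 Eab bar r0 fE.
have fL x y : E x -> E y -> `|f x - f y| <= L * `|x - y|.
  wlog xy : x y / x < y.
    move=> H Ex Ey; have [xy|xy|->] := ltgtP x y; first exact: H.
      by rewrite distrC (distrC x); exact: H.
    by rewrite !subrr !normr0 mulr0.
  move=> Ex Ey; rewrite distrC (distrC x) (gtr0_norm (_ : 0 < y - x)) ?subr_gt0//.
  have yxr : y - x < r.
    move: (Eab _ Ex) (Eab _ Ey); rewrite /= !in_itv/= => /andP[? ?] /andP[? ?].
    by lra.
  case: s fE => /= fE.
  - by have := fE y (y - x) Ey; rewrite subKr distrC; apply; rewrite ?subr_gt0.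
  - by have := fE x (y - x) Ex; rewrite subrKC; apply; rewrite ?subr_gt0.
have := negligibleU (ae_metrically_differentiable_on L0 Eab fL) (ae_both_sides_dense E).
apply: negligibleS => x [Ex /=]; apply: contra_notP => /not_orP[nm nd].
have {nm} [m mP] := contrapT (contra_not (conj Ex) nm).
have {nd} dP := contrapT (contra_not (conj Ex) nd).
exists m => e e0.
pose k := Num.min 1 (e / 2 / (L + `|m|)).
have Lm : 0 < L + `|m| by rewrite ltr_pwDl.
have k0 : 0 < k by rewrite lt_min ltr01 !divr_gt0.
have k1 : k <= 1 by rewrite ge_min lexx.
have ke : (L + `|m|) * k <= e / 2 by rewrite mulrC -ler_pdivlMr// ge_min lexx orbT.
have [d1 d10 d1P] := dP _ k0.
have [|d2 d20 d2P] := mP (e / 4); first by rewrite divr_gt0.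
pose d := Num.min (Num.min d1 r) (d2 / 2).
have d0 : 0 < d by rewrite !lt_min d10 r0 divr_gt0.
have approx y : `|y - x| < d -> exists y', [/\ E y', `|y - y'| <= k * `|y - x| &
    `|f y - f y'| <= L * (k * `|y - x|)].
  rewrite !lt_min => /andP[/andP[yd1 yr] _].
  have [->|yx] := eqVneq y x.
    by exists x; rewrite !subrr !normr0 !mulr0.
  have kr : k * `|y - x| < r by rewrite (le_lt_trans _ yr)// ler_piMl.
  have [[z Ez zP] [z' Ez' z'P]] := d1P _ yd1 yx.
  have fin w t : E w -> y = side s w t -> 0 <= t <= k * `|y - x| ->
      exists y', [/\ E y', `|y - y'| <= k * `|y - x| & `|f y - f y'| <= L * (k * `|y - x|)].
    move=> Ew yE /andP[t0 tk]; exists w; split => //.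
      rewrite {1}yE /side; case: s {fE yE} => /=.
        by rewrite addrAC subrr add0r normrN ger0_norm.
      by rewrite addrAC subrr add0r ger0_norm.
    rewrite {1}yE; move: t0; rewrite le_eqVlt => /predU1P[t0|t0].
      rewrite -t0 /side; case: s {fE yE}; rewrite ?subr0 ?addr0 subrr normr0;
      by rewrite !mulr_ge0// ltW.
    by rewrite (le_trans (fE _ _ Ew t0 (le_lt_trans tk kr)))// ler_pM2l.
  case: s {fE} fin => fin.
    by apply: (fin z' (z' - y)) => //=; [rewrite opprB subrKC|lra].
  by apply: (fin z (y - z)) => //=; [rewrite subrKC|lra].
exists d => // y z yd zd.
have [y' [Ey' yy fy]] := approx _ yd.
have [z' [Ez' zz fz]] := approx _ zd.
have ny := normr_ge0 (y - x); have nz := normr_ge0 (z - x).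
have y'x : `|y' - x| <= 2 * `|y - x|.
  have := ler_distD y y' x; rewrite (distrC y' y).
  have : k * `|y - x| <= `|y - x| by rewrite ler_piMl.
  by lra.
have z'x : `|z' - x| <= 2 * `|z - x|.
  have := ler_distD z z' x; rewrite (distrC z' z).
  have : k * `|z - x| <= `|z - x| by rewrite ler_piMl.
  by lra.
have := d2P y' z' Ey' Ez'.
move: yd zd; rewrite !lt_min => /andP[_ yd] /andP[_ zd].
move=> /(_ ltac:(lra) ltac:(lra)).
set Q := `|f y' - f z'|; set q := `|y' - z'|.
have fQ : `| `|f y - f z| - Q | <= L * k * (`|y - x| + `|z - x|).
  have := ler_dist_dist (f y - f z) (f y' - f z').
  have -> : f y - f z - (f y' - f z') = (f y - f y') - (f z - f z').
    by rewrite !opprB addrACA [RHS]addrACA; congr (_ + _); rewrite addrC.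
  have := ler_normB (f y - f y') (f z - f z').
  by rewrite /Q; lra.
have fq : `| `|y - z| - q | <= k * (`|y - x| + `|z - x|).
  have := ler_dist_dist (y - z) (y' - z').
  have -> : y - z - (y' - z') = (y - y') - (z - z') by ring.
  have := ler_normB (y - y') (z - z').
  by rewrite /q; lra.
have mq : `|m * (`|y - z| - q)| <= `|m| * (k * (`|y - x| + `|z - x|)).
  by rewrite normrM ler_wpM2l.
have ekS : (L + `|m|) * k * (`|y - x| + `|z - x|) <= e / 2 * (`|y - x| + `|z - x|).
  by rewrite ler_wpM2r// addr_ge0.
have eS : e / 4 * (`|y' - x| + `|z' - x|) <= e / 4 * (2 * `|y - x| + 2 * `|z - x|).
  by rewrite ler_pM2l ?divr_gt0// lerD.
move: fQ mq; rewrite !ler_norml; lra.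
Qed.

Lemma limf_esup_quotient_lty (q : R -> R) :
    (limf_esup (fun t => (q t / t)%:E) 0^'+ < +oo)%E ->
  exists n : nat, forall t, 0 < t -> t < n.+1%:R^-1 -> q t <= n.+1%:R * t.
Proof.
move=> /ereal_inf_lt[_ [V [d /= d0 dV] <-]] supV.
have [c cV] : exists c : R, forall t, V t -> q t / t <= c.
  have ub t : V t -> ((q t / t)%:E <= ereal_sup [set (q t / t)%:E | t in V])%E.
    by move=> Vt; apply: ereal_sup_ubound; exists t.
  move: supV ub; case: (ereal_sup _) => [c _ ub|//|_ ub]; last by exists 0 => t /ub.
  by exists c => t /ub; rewrite lee_fin.
pose n := Num.truncn (Num.max d^-1 c).
have nlt : Num.max d^-1 c < n.+1%:R by exact: truncnS_gt.
move: nlt; rewrite gt_max => /andP[nd nc].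
exists n => t t0 tn.
have Vt : V t.
  apply: dV => //=; rewrite sub0r normrN gtr0_norm// (lt_trans tn)//.
  by rewrite invf_plt ?posrE.
by rewrite -ler_pdivrMr// (le_trans (cV _ Vt))// ltW.
Qed.

End one_sided.

Theorem corollary3p7 (R : realType) (X : completeNormedModType R)
  (f : R -> X) :
  exists2 M : set R, (@lebesgue_measure R).-negligible M &
    forall x : R, ~ M x ->
      (Order.min (mD_minus f x) (mD_plus f x) < +oo)%E ->
      metrically_differentiable f x.
Proof.
pose E (i : bool * nat * rat) := [set x : R | (forall t, 0 < t -> t < i.1.2.+1%:R^-1 ->
    `|f (side i.1.1 x t) - f x| <= i.1.2.+1%:R * t) /\
  ratr i.2 - i.1.2.+1%:R^-1 / 4 <= x <= ratr i.2 + i.1.2.+1%:R^-1 / 4].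
pose N i := E i `&` ~` [set x | exists m, metric_slope f x m].
exists (\bigcup_n (if unpickle n is Some i then N i else set0)).
  apply: negligible_bigcup => n; case: unpickle => [i|]; last exact: negligible_set0.
  have n0 : 0 < i.1.2.+1%:R^-1 :> R by rewrite invr_gt0.
  apply: (@ae_metric_slope _ _ _ _ i.1.1 i.1.2.+1%:R i.1.2.+1%:R^-1
    (ratr i.2 - i.1.2.+1%:R^-1 / 4) (ratr i.2 + i.1.2.+1%:R^-1 / 4)) => //.
  - by move=> x [_]; rewrite /= in_itv.
  - by move: n0; move: (_^-1) => c; lra.
  - by move=> x t [h _]; exact: h.
move=> x Mx fx.
have [s [n snP]] : exists s n, forall t, 0 < t -> t < n.+1%:R^-1 ->
    `|f (side s x t) - f x| <= n.+1%:R * t.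
  by move: fx; rewrite gt_min => /orP[] /limf_esup_quotient_lty; [exists true|exists false].
have [m /metric_slopeW//] : exists m, metric_slope f x m.
apply: contrapT => nm; apply: Mx.
have n0 : 0 < n.+1%:R^-1 / 4 :> R by rewrite divr_gt0// invr_gt0.
have xx : x - n.+1%:R^-1 / 4 < x + n.+1%:R^-1 / 4 by rewrite ltrD2l gtrN.
have [q] := rat_in_itvoo xx; rewrite in_itv/= => /andP[q1 q2].
exists (pickle (s, n, q)) => //; rewrite pickleK; split => //; split => //=.
by move: q1 q2; move: (_ / 4) => c; lra.
Qed.
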